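(* OTVW restricted to instances $(G,\omega,\tau)$ in which $\tau(u)\in\left\{\sum_{e\in E(u,G)}\omega(e)-\mu(G,\omega),\ \sum_{e\in E(u,G)}\omega(e)\right\}$ for every $u\in V(G)$ can be solved in polynomial time.
   Context: An edge-weighted graph is a triple $(G,\omega,\tau)$ with $G=(V,E)$ a finite simple graph, $\omega:E\to[0,\infty)$ and $\tau:V\to[0,\infty)$. $E(u,G)$ is the set of edges incident to $u$, and $\mu(G,\omega)=\min\{\omega(e):e\in E(G)\}$. An incentive assignment is $\mathbf{p}:V\to[0,\infty)$. The activation process for $(G,\omega,\tau,\mathbf{p})$: initially $A_0=\{v:p(v)\ge\tau(v)\}$; given the active set $A_t$, a vertex $x\notin A_t$ becomes active in round $t+1$ iff $\sum_{e\in E_t(x)}\omega(e)+p(x)\ge\tau(x)$, where $E_t(x)$ is the set of edges $xy$ with $y\in A_t$; active vertices remain active. $\mathbf{p}$ is a target vector if the process eventually activates all of $V$. OTVW asks for a target vector minimizing $\sum_{v\in V}p(v)$. *)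

(* Defs.v *)
From HB Require Import structures.
From mathcomp Require Import all_boot all_order all_algebra.
From mathcomp Require Import reals.

Set Implicit Arguments.
Unset Strict Implicit.
Unset Printing Implicit Defensive.

Import Order.TTheory GRing.Theory Num.Theory.
Local Open Scope ring_scope.

(* An edge is a two-element set of vertices; [weight] is a total function of
   which only the values on [edges] are ever used. *)
Record ewgraph (K : realFieldType) := EWGraph {
  vertex : finType;
  edges : {set {set vertex}};
  weight : {set vertex} -> K;
  threshold : vertex -> K;
  edges_card2 : forall e, e \in edges -> #|e| = 2%N;
  weight_ge0 : forall e, e \in edges -> 0 <= weight e;
  threshold_ge0 : forall v, 0 <= threshold v
}.

Definition incident (K : realFieldType) (G : ewgraph K) (u : vertex G) :
    {set {set vertex G}} :=
  [set e in edges G | u \in e].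

(* The minimum over no edge at all is fixed to be 0. *)
Definition min_weight (K : realFieldType) (G : ewgraph K) : K :=
  if [pick e in edges G] is Some e0
  then \big[Num.min/weight e0]_(e in edges G) weight e
  else 0.

Definition edges_to (K : realFieldType) (G : ewgraph K)
    (A : {set vertex G}) (x : vertex G) : {set {set vertex G}} :=
  [set e in edges G | [exists y in A, e == [set x; y]]].

Fixpoint active (K : realFieldType) (G : ewgraph K) (p : vertex G -> K)
    (t : nat) : {set vertex G} :=
  if t is t'.+1 then
    let A := active p t' in
    A :|: [set x | (x \notin A) &&
             (threshold x <= \sum_(e in edges_to A x) weight e + p x)]
  else [set v | threshold v <= p v].

Definition target_vector (K : realFieldType) (G : ewgraph K)
    (p : vertex G -> K) : Prop :=
  (forall v, 0 <= p v) /\ exists t, active p t = [set: vertex G].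

Definition optimal_target_vector (K : realFieldType) (G : ewgraph K)
    (p : vertex G -> K) : Prop :=
  target_vector p /\
  forall p' : vertex G -> K, target_vector p' ->
    \sum_v p v <= \sum_v p' v.

Lemma real_weight_ge0 (R : realType) (G : ewgraph rat) (e : {set vertex G}) :
  e \in edges G -> 0 <= ratr (weight e) :> R.
Proof. by move=> eG; rewrite ler0q weight_ge0. Qed.

Lemma real_threshold_ge0 (R : realType) (G : ewgraph rat) (v : vertex G) :
  0 <= ratr (threshold v) :> R.
Proof. by rewrite ler0q threshold_ge0. Qed.

Definition real_ewgraph (R : realType) (G : ewgraph rat) : ewgraph R :=
  EWGraph (@edges_card2 _ G) (@real_weight_ge0 R G) (@real_threshold_ge0 R G).

(* A program has a memory of natural numbers (for indices and control), a
   memory of elements of the ordered field K, read-only random access to its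
   input, and a write-only output tape.  All cells initially contain 0.
   Programs do not depend on K and can only add, subtract and compare
   elements of K, so the unit-cost real model cannot be abused (no products,
   no rounding). *)
Inductive iexpr :=
  | ICst of nat
  | ICell of iexpr
  | IIn of iexpr
  | IAdd of iexpr & iexpr
  | ISub of iexpr & iexpr
  | IMul of iexpr & iexpr
  | IDiv of iexpr & iexpr.

Inductive nexpr :=
  | NCell of iexpr
  | NIn of iexpr
  | NAdd of nexpr & nexpr
  | NSub of nexpr & nexpr.

Inductive test :=
  | ILt of iexpr & iexpr
  | NLt of nexpr & nexpr
  | TNot of test.

Inductive cmd :=
  | Skip
  | ISet of iexpr & iexpr
  | NSet of iexpr & nexpr
  | Write of nexpr
  | Seq of cmd & cmd
  | If of test & cmd & cmd
  | While of test & cmd.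

Record input (K : Type) := Input { iinput : seq nat; ninput : seq K }.

Record state (K : Type) :=
  State { icell : nat -> nat; ncell : nat -> K; output : seq K }.

Definition init_state (K : realFieldType) : state K :=
  State (fun _ => 0%N) (fun _ => 0) [::].

Fixpoint ival (K : realFieldType) (x : input K) (s : state K) (e : iexpr) :
    nat :=
  match e with
  | ICst n => n
  | ICell a => icell s (ival x s a)
  | IIn a => nth 0%N (iinput x) (ival x s a)
  | IAdd a b => (ival x s a + ival x s b)%N
  | ISub a b => (ival x s a - ival x s b)%N
  | IMul a b => (ival x s a * ival x s b)%N
  | IDiv a b => (ival x s a %/ ival x s b)%N
  end.

Fixpoint nval (K : realFieldType) (x : input K) (s : state K) (e : nexpr) : K :=
  match e with
  | NCell a => ncell s (ival x s a)
  | NIn a => nth 0 (ninput x) (ival x s a)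
  | NAdd a b => nval x s a + nval x s b
  | NSub a b => nval x s a - nval x s b
  end.

Fixpoint tval (K : realFieldType) (x : input K) (s : state K) (b : test) :
    bool :=
  match b with
  | ILt a b => (ival x s a < ival x s b)%N
  | NLt a b => nval x s a < nval x s b
  | TNot b => ~~ tval x s b
  end.

(* Number of binary digits, with the usual convention bitlen 0 = 1. *)
Definition bitlen (n : nat) : nat := (trunc_log 2 n).+1.

(* Logarithmic cost: an operation costs 1 plus the sizes of its operands
   (addresses included).  The size of an element of K is a parameter [len]. *)
Fixpoint icost (K : realFieldType) (x : input K) (s : state K) (e : iexpr) :
    nat :=
  match e with
  | ICst n => (1 + bitlen n)%N
  | ICell a | IIn a =>
      (1 + icost x s a + bitlen (ival x s a) + bitlen (ival x s e))%N
  | IAdd a b | ISub a b | IMul a b | IDiv a b =>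
      (1 + icost x s a + icost x s b
         + bitlen (ival x s a) + bitlen (ival x s b))%N
  end.

Fixpoint ncost (K : realFieldType) (len : K -> nat) (x : input K) (s : state K)
    (e : nexpr) : nat :=
  match e with
  | NCell a | NIn a =>
      (1 + icost x s a + bitlen (ival x s a) + len (nval x s e))%N
  | NAdd a b | NSub a b =>
      (1 + ncost len x s a + ncost len x s b
         + len (nval x s a) + len (nval x s b))%N
  end.

Fixpoint tcost (K : realFieldType) (len : K -> nat) (x : input K) (s : state K)
    (b : test) : nat :=
  match b with
  | ILt a b =>
      (1 + icost x s a + icost x s b
         + bitlen (ival x s a) + bitlen (ival x s b))%N
  | NLt a b =>
      (1 + ncost len x s a + ncost len x s b
         + len (nval x s a) + len (nval x s b))%N
  | TNot b => (1 + tcost len x s b)%N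
  end.

(* [exec len x c s t s'] : on input x, started in state s, the program c
   halts in state s' with running time t. *)
Inductive exec (K : realFieldType) (len : K -> nat) (x : input K) :
    cmd -> state K -> nat -> state K -> Prop :=
  | ExecSkip s : exec len x Skip s 1 s
  | ExecISet a e s :
      exec len x (ISet a e) s
        (1 + icost x s a + icost x s e
           + bitlen (ival x s a) + bitlen (ival x s e))
        (State [eta icell s with ival x s a |-> ival x s e]
               (ncell s) (output s))
  | ExecNSet a e s :
      exec len x (NSet a e) s
        (1 + icost x s a + ncost len x s e
           + bitlen (ival x s a) + len (nval x s e))
        (State (icell s)
               [eta ncell s with ival x s a |-> nval x s e] (output s))
  | ExecWrite e s :
      exec len x (Write e) s (1 + ncost len x s e + len (nval x s e))
        (State (icell s) (ncell s) (rcons (output s) (nval x s e)))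
  | ExecSeq c1 c2 s1 s2 s3 t1 t2 :
      exec len x c1 s1 t1 s2 -> exec len x c2 s2 t2 s3 ->
      exec len x (Seq c1 c2) s1 (1 + t1 + t2) s3
  | ExecIf b c1 c2 s s' t :
      exec len x (if tval x s b then c1 else c2) s t s' ->
      exec len x (If b c1 c2) s (1 + tcost len x s b + t) s'
  | ExecWhileDone b c s :
      ~~ tval x s b ->
      exec len x (While b c) s (1 + tcost len x s b) s
  | ExecWhileStep b c s1 s2 s3 t1 t2 :
      tval x s1 b ->
      exec len x c s1 t1 s2 -> exec len x (While b c) s2 t2 s3 ->
      exec len x (While b c) s1 (1 + tcost len x s1 b + t1 + t2) s3.

Definition input_size (K : Type) (len : K -> nat) (x : input K) : nat :=
  (\sum_(n <- iinput x) bitlen n + \sum_(a <- ninput x) len a)%N.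

(* The (search) problem asking, for instances i satisfying D, encoded by enc,
   for an output related to i by sol, is solved in polynomial time. *)
Definition solvable_in_polytime (K : realFieldType) (len : K -> nat)
    (I : Type) (enc : I -> input K) (D : I -> Prop)
    (sol : I -> seq K -> Prop) : Prop :=
  exists (c : cmd) (q : {poly nat}), forall i : I, D i ->
    exists (t : nat) (s : state K),
      [/\ exec len (enc i) c (init_state K) t s,
          (t <= q.[input_size len (enc i)])%N
        & sol i (output s)].

(* Unit-cost arithmetic on real numbers. *)
Definition unit_len (K : Type) (_ : K) : nat := 1%N.

(* Bit length of the reduced fraction, including one bit for the sign. *)
Definition rat_len (a : rat) : nat :=
  (1 + bitlen `|numq a|%N + bitlen `|denq a|%N)%N.

(* Number of vertices, adjacency matrix; thresholds, matrix of weights. *)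
Definition encode (K : realFieldType) (G : ewgraph K) : input K :=
  Input
    (#|vertex G| ::
       [seq nat_of_bool ([set u; v] \in edges G)
          | u <- enum (vertex G), v <- enum (vertex G)])
    ([seq threshold v | v <- enum (vertex G)] ++
       [seq if [set u; v] \in edges G then weight [set u; v] else 0
          | u <- enum (vertex G), v <- enum (vertex G)]).

Definition otvw_real (R : realType) (G : ewgraph R) (out : seq R) : Prop :=
  exists p : vertex G -> R,
    optimal_target_vector p /\ out = [seq p v | v <- enum (vertex G)].

(* Optimality of the rational output is among all real target vectors. *)
Definition otvw_rat (R : realType) (G : ewgraph rat) (out : seq rat) : Prop :=
  exists p : vertex G -> rat,
    @optimal_target_vector R (real_ewgraph R G) (fun v => ratr (p v)) /\
    out = [seq p v | v <- enum (vertex G)].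

(* Polynomial time both for arbitrary real data (unit-cost additive real RAM)
   and for rational data in the bit model. *)
Definition otvw_polytime (R : realType)
    (D : forall K : realFieldType, ewgraph K -> Prop) : Prop :=
  solvable_in_polytime (@unit_len R) (@encode R) (@D R) (@otvw_real R) /\
  solvable_in_polytime rat_len (@encode rat) (@D rat) (@otvw_rat R).

(* Main.v *)
(* For a ranking of the vertices, meaning that [v] is activated after all
   vertices of larger rank, the cheapest payments cost the total edge weight
   minus mu for each discounted vertex (threshold below its degree by mu > 0)
   that has a neighbour of smaller rank.  The last vertex of a component
   consisting of discounted vertices only is stuck, i.e. it saves nothing.
   Assigning the ranks 1, 2, ... greedily, preferring vertices that are not
   discounted or have a ranked neighbour, a discounted vertex gets stuck only
   once in each such component and in no other one, which is optimal. *)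

Require Import Defs.
From mathcomp Require Import all_boot all_order all_algebra.
From mathcomp Require Import reals zify ring.
From mathcomp Require boolp.

Set Implicit Arguments.
Unset Strict Implicit.
Unset Printing Implicit Defensive.

Import Order.TTheory GRing.Theory Num.Theory.
Local Open Scope ring_scope.

(** * Optimality of greedy rankings *)

(** For an injective ranking, [threshold v - above rk v] equals [below rk v], minus [mu] if [v] is
    discounted. Summed over all vertices, [below] counts every edge once, so this total is the same
    for all rankings, and rankings differ only by the truncation of negative payments at 0. Since no
    edge weighs less than [mu], one neighbour of smaller rank already makes the difference
    nonnegative; truncation thus acts at the stuck vertices only and wastes [mu] at each. Optimality
    becomes the minimality of the number of stuck vertices. An arbitrary target vector enters the
    comparison through its order of activation, reversed. The program never computes [mu]: it only
    compares thresholds with degrees. All numbers it handles are signed sums of polynomially many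
    inputs, and this single fact bounds the running time in both cost models. *)

Section Optimality.
Variables (K : realFieldType) (G : ewgraph K).
Implicit Types (u v w : vertex G) (rk : vertex G -> nat).

Definition adj u v : bool := [set u; v] \in edges G.

(** The value 0 off the edges turns sums over edge sets into sums over vertices and agrees with the
    weight matrix of the encoding. *)
Definition adj_weight u v : K := if adj u v then weight [set u; v] else 0.

Definition degree v : K := \sum_u adj_weight v u.

Lemma adj_irr v : adj v v = false.
Proof.
by apply/negP => /edges_card2; rewrite setUid cards1.
Qed.

Lemma adjC u v : adj u v = adj v u.
Proof. by rewrite /adj setUC. Qed.

Lemma adj_weightC u v : adj_weight u v = adj_weight v u.
Proof. by rewrite /adj_weight adjC setUC. Qed.

Lemma adj_weight_ge0 u v : 0 <= adj_weight u v.
Proof. by rewrite /adj_weight; case: ifP => // /weight_ge0. Qed.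

Lemma sum_edges_to (A : {set vertex G}) v :
  \sum_(e in edges_to A v) weight e = \sum_(u in A) adj_weight v u.
Proof.
have -> : edges_to A v = [set [set v; u] | u in A & adj v u].
  apply/setP => e; rewrite inE; apply/andP/imsetP => [[eG]|[u]].
    by case/exists_inP => u uA /eqP eE; exists u; rewrite // inE uA /adj -eE.
  rewrite inE => /andP[uA vu] ->; split=> //.
  by apply/exists_inP; exists u.
(* A neighbour [u] can be recovered from [[set v; u]] because no vertex is adjacent to itself. *)
rewrite big_imset /= => [|u w]; last first.
  rewrite !inE => /andP[_ vu] /andP[_ vw] /setP/(_ u).
  rewrite !inE eqxx orbT; case: (u =P v) => [uv|_ /esym/eqP //].
  by rewrite uv adj_irr in vu.
rewrite [RHS]big_mkcond [LHS]big_mkcond /=; apply: eq_bigr => u _.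
by rewrite inE /adj_weight; case: (u \in A); case: (adj v u).
Qed.

Lemma sum_incident v : \sum_(e in incident v) weight e = degree v.
Proof.
have -> : incident v = edges_to setT v.
  apply/setP => e; rewrite !inE; case eG: (e \in edges G) => //=.
  apply/idP/exists_inP => [ve|[u _ /eqP ->]]; last by rewrite !inE eqxx.
  have : #|e :\ v| = 1%N by have := edges_card2 eG; rewrite (cardsD1 v) ve => -[].
  by move/eqP/cards1P => [u uE]; exists u; rewrite // -uE setD1K.
by rewrite sum_edges_to; apply: eq_bigl => u; rewrite inE.
Qed.

Definition above rk v : K := \sum_(u | (rk v < rk u)%N) adj_weight v u.

Definition below rk v : K := \sum_(u | (rk u < rk v)%N) adj_weight v u.

Lemma below_ge0 rk v : 0 <= below rk v.
Proof. by apply: sumr_ge0 => u _; apply: adj_weight_ge0. Qed.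

Lemma above_below rk v : injective rk -> above rk v + below rk v = degree v.
Proof.
move=> rkI; rewrite /degree (bigID (fun u => (rk v < rk u)%N)) /=; congr (_ + _).
rewrite /below [RHS]big_mkcond [LHS]big_mkcond; apply: eq_bigr => u _ /=.
case: ltngtP => // /rkI ->; by rewrite /adj_weight adj_irr.
Qed.

Lemma sum_below_above rk : \sum_v below rk v = \sum_v above rk v.
Proof.
rewrite (eq_bigr (fun v => \sum_u if (rk u < rk v)%N then adj_weight v u else 0)).
  rewrite exchange_big; apply: eq_bigr => v _; rewrite /above [RHS]big_mkcond.
  by apply: eq_bigr => u _; rewrite adj_weightC.
by move=> v _; rewrite /below big_mkcond.
Qed.

(* Every edge is counted at its endpoint of larger rank. *)
Lemma sum_below rk : injective rk -> \sum_v below rk v *+ 2 = \sum_v degree v.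
Proof.
move=> rkI; under eq_bigr do rewrite mulr2n.
rewrite big_split /= {1}sum_below_above -big_split /=.
by apply: eq_bigr => v _; rewrite above_below.
Qed.

(* The vertices activated before [v] are those of larger rank. *)
Definition rank_payment rk v : K :=
  if threshold v < above rk v then 0 else threshold v - above rk v.

Definition discounted v : bool := threshold v < degree v.

(** The vertices ranked no lower than [v] form a union of components, all discounted: the situation
    in which the greedy choice has to take a discounted vertex without ranked neighbour. *)
Definition isolated_in_rank rk v : Prop :=
  forall u, (rk v <= rk u)%N ->
    discounted u /\ forall w, adj u w -> (rk v <= rk w)%N.

Definition greedy_rank rk : Prop :=
  injective rk /\
  forall v, [\/ ~~ discounted v, exists2 u, adj v u & (rk u < rk v)%N
    | isolated_in_rank rk v].

Lemma rank_payment_ge0 rk v : 0 <= rank_payment rk v.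
Proof. by rewrite /rank_payment; case: ltP => // ?; rewrite subr_ge0. Qed.

Lemma rank_payment_ge rk v : threshold v - above rk v <= rank_payment rk v.
Proof.
by rewrite /rank_payment; case: ltP => // ?; rewrite subr_le0 ltW.
Qed.

Lemma rank_payment_target rk : target_vector (rank_payment rk).
Proof.
split=> [v|]; first exact: rank_payment_ge0.
(* [N] exceeds every rank, so the claim is vacuous at round 0; each further round reaches one rank
   lower. *)
pose N := (\max_v rk v).+1; exists N.
have H t v : (N <= rk v + t)%N -> v \in active (rank_payment rk) t; last first.
  by apply/setP => v; rewrite H ?in_setT ?leq_addl.
elim: t v => [|t IH] v; first by have := leq_bigmax (F := rk) v; rewrite /N; lia.
move=> Nv; rewrite /= !inE.
case vA: (v \in _) => //=.
rewrite sum_edges_to -lerBlDl; apply: le_trans (rank_payment_ge _ _).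
rewrite lerD2l lerN2 /above [leRHS]big_mkcond [leLHS]big_mkcond /=.
apply: ler_sum => u _; case: ifP => uv; last by case: ifP; rewrite ?adj_weight_ge0.
by rewrite IH //; lia.
Qed.

Lemma target_vector_rank p : target_vector p ->
  exists2 rk, injective rk & forall v, threshold v - below rk v <= p v.
Proof.
case=> p0 [T pT].
have vA v : exists t, v \in active p t by exists T; rewrite pT inE.
pose t v := ex_minn (vA v).
have tP v : v \in active p (t v) /\ forall i, v \in active p i -> (t v <= i)%N.
  by rewrite /t; case: ex_minnP.
(* Vertices are ordered by activation round, ties being broken by the enumeration. Ranks increase
   with time here, hence [below] in the bound. *)
move: t tP => t tP; pose rk v := (t v * #|vertex G| + enum_rank v)%N.
have rk_lt u v : (t u < t v)%N -> (rk u < rk v)%N.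
  move=> tuv; apply: leq_trans (leq_addr _ _).
  apply: (@leq_trans ((t u).+1 * #|vertex G|)); last by rewrite leq_mul2r tuv orbT.
  by rewrite /rk mulSn addnC ltn_add2r.
exists rk => [u v rkE|v].
  apply/enum_rank_inj/val_inj => /=.
  case: (ltngtP (t u) (t v)) => [/rk_lt|/rk_lt|tE]; rewrite ?rkE ?ltnn //.
  by move: rkE; rewrite /rk tE => /addnI.
rewrite lerBlDr.
suff [A Alt Ale] : exists2 A : {set vertex G},
    (forall u, u \in A -> t u < t v)%N &
    threshold v <= \sum_(u in A) adj_weight v u + p v.
  apply: le_trans Ale _; rewrite addrC lerD2l /below.
  rewrite [leRHS]big_mkcond [leLHS]big_mkcond.
  apply: ler_sum => u _ /=; case: ifP => [/Alt/rk_lt -> //|_].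
  by case: ifP => _; rewrite ?adj_weight_ge0.
have [] := tP v; case: (t v) => [|i] vi imin.
  by exists set0 => [u|]; rewrite ?inE // big_set0 add0r; move: vi; rewrite /= inE.
have vNi : v \notin active p i by apply/negP => /imin; rewrite ltnn.
exists (active p i) => [u ui|]; first by rewrite ltnS (tP u).2.
by move: vi; rewrite /= !inE (negPf vNi) /= sum_edges_to.
Qed.

(** * Comparison of rankings through their stuck vertices *)

Section LowerBound.
Variable mu : K.
Hypotheses (mu_ge0 : 0 <= mu) (mu_le : forall e, e \in edges G -> mu <= weight e).
Hypothesis threshold_mem :
  forall v, threshold v \in [:: degree v - mu; degree v].

Lemma thresholdE v : threshold v = degree v - (if discounted v then mu else 0).
Proof.
rewrite /discounted; have := threshold_mem v; rewrite !inE.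
(* A threshold [degree v - mu] that is not below the degree forces [mu = 0], and then the two
   admissible values coincide. *)
case/orP => /eqP ->; last by rewrite ltxx subr0.
case: ltP => //; rewrite lerBrDl gerDr => mu0; congr (_ - _); exact/le_anti/andP.
Qed.

Definition stuck rk v : bool :=
  discounted v && [forall u, adj v u ==> (rk v <= rk u)%N].

(** The payment before truncation at 0; it may be negative. *)
Definition ideal_payment rk v : K := below rk v - (if discounted v then mu else 0).

Lemma stuck_below rk v : stuck rk v -> below rk v = 0.
Proof.
case/andP => _ /forallP vN; apply: big1 => u uv; rewrite /adj_weight.
by case: ifP => // vu; have := vN u; rewrite vu /= leqNgt uv.
Qed.

(** A single edge to a lower neighbour already weighs at least [mu]. *)
Lemma not_stuck_below rk v : discounted v -> ~~ stuck rk v -> mu <= below rk v.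
Proof.
rewrite /stuck => -> /= /forallPn[u]; rewrite negb_imply -ltnNge => /andP[vu uv].
rewrite /below (bigD1 u) //= -[mu]addr0 lerD //.
  by rewrite /adj_weight vu mu_le.
by apply: sumr_ge0 => w _; apply: adj_weight_ge0.
Qed.

Lemma threshold_above rk v : injective rk ->
  threshold v - above rk v = ideal_payment rk v.
Proof.
move=> rkI; rewrite thresholdE -(above_below v rkI).
by rewrite [above _ _ + _]addrC addrAC addrK.
Qed.

(** At a stuck vertex the ideal payment is [- mu], so that [0 <= a] is the stronger of the two
    bounds there. *)
Lemma payment_ge rk v a : injective rk ->
  0 <= a -> threshold v - above rk v <= a ->
  ideal_payment rk v + (if stuck rk v then mu else 0) <= a.
Proof.
move=> rkI a0; rewrite threshold_above // => ale.
case vS: (stuck rk v); last by rewrite addr0.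
by rewrite /ideal_payment stuck_below //; case/andP: vS => -> _; rewrite sub0r addNr.
Qed.

(** Unless [v] is stuck, [below rk v] covers the discount and nothing is truncated; if it is stuck,
    truncation adds exactly [mu]. *)
Lemma rank_paymentE rk v : injective rk ->
  rank_payment rk v = ideal_payment rk v + (if stuck rk v then mu else 0).
Proof.
move=> rkI; have pE := threshold_above v rkI; rewrite /rank_payment pE.
case: (boolP (stuck rk v)) => vS.
  have iE : ideal_payment rk v = - mu.
    by rewrite /ideal_payment stuck_below //; case/andP: vS => [-> _]; rewrite sub0r.
  case: ltP; rewrite iE addNr // -subr_ge0 pE iE oppr_ge0 => mu_le0.
  by have -> : mu = 0; [apply/le_anti; rewrite mu_le0 | rewrite oppr0].
rewrite addr0 ifN // -leNgt -subr_ge0 pE /ideal_payment.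
by case: ifP => [vD|_]; rewrite ?subr0 ?below_ge0 // subr_ge0 not_stuck_below.
Qed.

Lemma sum_payment rk :
  \sum_v (ideal_payment rk v + (if stuck rk v then mu else 0)) =
  \sum_v ideal_payment rk v + mu *+ #|stuck rk|.
Proof. by rewrite big_split /= -big_mkcond sumr_const. Qed.

Lemma sum_ideal_payment rk rk' : injective rk -> injective rk' ->
  \sum_v ideal_payment rk v = \sum_v ideal_payment rk' v.
Proof.
move=> rkI rkI'; rewrite !big_split /=; congr (_ + _).
(* Doubled, both sums of [below] equal the sum of the degrees. *)
by apply: (@pmulrnI _ 2) => //=; rewrite -!sumrMnl !sum_below.
Qed.

Lemma stuck_isolated rk v : greedy_rank rk -> stuck rk v -> isolated_in_rank rk v.
Proof.
case=> _ rkG /andP[vD /forallP vN].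
case: (rkG v) => [|[u vu]|//]; first by rewrite vD.
by have := vN u; rewrite vu /= leqNgt => /negP.
Qed.

Lemma isolated_connect rk v u : isolated_in_rank rk v -> connect adj v u ->
  (rk v <= rk u)%N.
Proof.
move=> vI /connectP[s]; elim/last_ind: s u => [|s w IH] u /=; first by move=> _ ->.
rewrite rcons_path last_rcons => /andP[vs sw] ->.
by have [_] := vI _ (IH _ vs erefl); apply.
Qed.

(* Each component containing a stuck vertex of a greedy ranking consists of
   discounted vertices only, and every ranking gets stuck at its lowest vertex
   there. *)
Lemma card_stuck rk rk' : greedy_rank rk -> injective rk' ->
  (#|stuck rk| <= #|stuck rk'|)%N.
Proof.
move=> rkG rkI'; have rkI := rkG.1.
have adj_sym : connect_sym adj by apply: sym_connect_sym; exact: adjC.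
pose low v := [arg min_(u < v | connect adj v u) rk' u].
have lowP v : connect adj v (low v) /\
    forall u, connect adj v u -> (rk' (low v) <= rk' u)%N.
  by rewrite /low; case: arg_minnP => // u vu umin; split.
rewrite -(card_in_image (f := low)) => [|u v uS vS uv].
  apply/subset_leq_card/subsetP => _ /imageP[v vS ->].
  have [vl lmin] := lowP v; have vI := stuck_isolated rkG vS.
  have [lD _] := vI _ (isolated_connect vI vl).
  rewrite unfold_in /stuck lD; apply/forallP => u; apply/implyP => lu.
  by apply: lmin; apply: connect_trans vl (connect1 lu).
have uv' : connect adj u v.
  have [ul _] := lowP u; have [vl _] := lowP v.
  by apply: connect_trans ul _; rewrite adj_sym uv.
(* Of two stuck vertices in one component, each is ranked no higher than the other. *)
apply/rkI/eqP; rewrite eqn_leq.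
rewrite (isolated_connect (stuck_isolated rkG uS) uv').
by rewrite (isolated_connect (stuck_isolated rkG vS)) // adj_sym.
Qed.

Lemma greedy_rank_optimal rk : greedy_rank rk ->
  optimal_target_vector (rank_payment rk).
Proof.
move=> rkG; split=> [|p pT]; first exact: rank_payment_target.
have [rk' rkI' pge] := target_vector_rank pT; have rkI := rkG.1.
(* Reversing the order of activation turns [below rk'] into [above rk'']. *)
pose rk'' v := (\max_u rk' u - rk' v)%N.
have le_max v : (rk' v <= \max_u rk' u)%N by exact: leq_bigmax.
have rkI'' : injective rk''.
  move=> u v; rewrite /rk'' => uv; apply: rkI'.
  by have := le_max u; have := le_max v; lia.
apply: (@le_trans _ _ (\sum_v (ideal_payment rk'' v
                                + if stuck rk'' v then mu else 0))).
  under eq_bigr do rewrite rank_paymentE //.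
  rewrite !sum_payment (sum_ideal_payment rkI rkI'') lerD2l.
  by apply: ler_wpMn2l => //; apply: card_stuck.
apply: ler_sum => v _; apply: payment_ge => //; first exact: pT.1.
apply: le_trans (pge v); rewrite lerD2l lerN2 /above /below le_eqVlt.
apply/orP; left; apply/eqP/eq_bigl => u; rewrite /rk''.
by have := le_max u; have := le_max v; lia.
Qed.

End LowerBound.
End Optimality.

(** * The greedy program *)

Section PartialRank.
Variables (n : nat) (good : pred nat) (link : rel nat).
Implicit Types (r : nat -> nat) (c u v w : nat).

Definition picked r v : bool := (0 < r v)%N.

Definition reachable r v : Prop :=
  exists2 u, (u < n)%N & link v u && picked r u.

(** Unpicked vertices satisfy the premise on [u] too. The condition can therefore be established
    when [v] is picked, and it survives later picks, whose ranks are larger. *)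
Definition isolated r v : Prop :=
  forall u, (u < n)%N -> (picked r u -> r v <= r u)%N ->
    ~~ good u /\ forall w, (w < n)%N -> link u w -> picked r w -> (r v <= r w)%N.

(* Rank [0] means that the vertex has not been picked yet. *)
Definition partial_rank c r : Prop :=
  [/\ (\sum_(v < n) (r v == 0) + c)%N = n,
      forall v, (v < n)%N -> (r v <= c)%N,
      forall u v, (u < n)%N -> (v < n)%N -> picked r u -> r u = r v -> u = v
    & forall v, (v < n)%N -> picked r v ->
      [\/ good v,
          exists2 u, (u < n)%N & [&& link v u, picked r u & (r u < r v)%N]
        | isolated r v]].

Lemma partial_rank0 r : (forall v, r v = 0%N) -> partial_rank 0 r.
Proof.
move=> r0; split=> [|v _|u v _ _|v _]; rewrite /picked ?r0 //.
under eq_bigr do rewrite r0.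
by rewrite sum_nat_const card_ord addn0 muln1.
Qed.

Lemma partial_rank_unpicked c r : partial_rank c r -> (c < n)%N ->
  exists2 v, (v < n)%N & r v = 0%N.
Proof.
case=> sum_r _ _ _ cn.
have /existsP[v /eqP rv] : [exists v : 'I_n, r v == 0].
  apply: contraLR cn => /existsPn H; rewrite -leqNgt -{1}sum_r big1 // => v _.
  by rewrite (negPf (H v)).
by exists v.
Qed.

Lemma partial_rank_picked r v : partial_rank n r -> (v < n)%N -> picked r v.
Proof.
case=> sum_r _ _ _ vn; rewrite /picked lt0n; apply/negP => rv0.
by move: sum_r; rewrite (bigD1 (Ordinal vn)) //= rv0; lia.
Qed.

(** The new vertex has the largest rank, so witnesses found for earlier vertices persist. If no
    unpicked vertex is good or reachable, then [a] becomes isolated. *)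
Lemma partial_rankS c r r' a : partial_rank c r ->
  (a < n)%N -> r a = 0%N ->
  (forall v, r' v = if v == a then c.+1 else r v) ->
  [\/ good a, reachable r a
    | forall v, (v < n)%N -> r v = 0%N -> ~~ good v /\ ~ reachable r v] ->
  partial_rank c.+1 r'.
Proof.
case=> sum_r r_le r_inj r_ok an ra r'E a_ok.
have r'a : r' a = c.+1 by rewrite r'E eqxx.
have r'N v : v != a -> r' v = r v by rewrite r'E => /negPf ->.
have pickE v : picked r' v = (v == a) || picked r v.
  by rewrite /picked r'E; case: eqP.
split=> [|v vn|u v un vn|v vn].
- rewrite -[RHS]sum_r [in LHS](bigD1 (Ordinal an)) //=.
  rewrite [in RHS](bigD1 (Ordinal an)) //=.
  rewrite ra r'a /=.
  rewrite (eq_bigr (fun v : 'I_n => nat_of_bool (r v == 0))) => [|v va].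
    by rewrite add0n addnS add1n addSn.
  by rewrite r'N.
- by rewrite r'E; case: eqP => // _; rewrite leqW ?r_le.
- rewrite pickE !r'E; case: (u =P a) => [->|_]; case: (v =P a) => [->|_] //=.
  + by move=> _ cE; have := r_le v vn; rewrite -cE ltnn.
  + by move=> _ cE; have := r_le u un; rewrite cE ltnn.
  + exact: r_inj.
rewrite pickE; case: (v =P a) => [-> _|/eqP va /= vP].
  case: a_ok => [|[u un /andP[au uP]]|a_ok]; first by constructor 1.
    constructor 2; exists u => //; rewrite au pickE uP orbT r'a r'N ?ltnS ?r_le //.
    by apply: contraTneq uP => ->; rewrite /picked ra.
  constructor 3 => u un; rewrite r'a pickE => ua.
  (* Earlier ranks are at most [c], so only [a] and unpicked vertices pass the premise. *)
  have ru : r u = 0%N.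
    case: (u =P a) ua => [-> //|/eqP ua /=]; rewrite r'N // /picked.
    by case: (r u) (r_le u un) => // k kc /(_ isT); lia.
  have [gu nu] := a_ok u un ru; split=> // w wn uw; rewrite pickE.
  case: eqP => [-> _|_ /= wP]; first by rewrite r'a.
  by case: nu; exists w; rewrite ?uw.
have rv : (r v <= c)%N by exact: r_le.
have [gv|[u un /and3P[vu uP ruv]]|vI] := r_ok v vn vP; first by constructor 1.
  constructor 2; exists u => //; rewrite vu pickE uP orbT !r'N //.
  by apply: contraTneq uP => ->; rewrite /picked ra.
constructor 3 => u un; rewrite pickE (r'N _ va) => ua.
have [|gu uI] := vI u un.
  move=> uP; move: ua; rewrite uP orbT r'N; first by apply.
  by apply: contraTneq uP => ->; rewrite /picked ra.
split=> // w wn uw; rewrite pickE r'E.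
case: eqP => [_ _|_ /=]; first by rewrite leqW.
exact: uI.
Qed.

End PartialRank.

(* Integer cells 0 to 2 hold the loop counter, the candidate and the number of
   ranked vertices, cell 3 + v the rank of v (0 if it has none).  Number cell v
   is for the degree of v, cell n + v for the weight coming from larger ranks. *)
Local Notation size_ := (IIn (ICst 0)).
Local Notation counter := (ICell (ICst 0)).
Local Notation candidate := (ICell (ICst 1)).
Local Notation rank_count := (ICell (ICst 2)).
Local Notation row_index := (IDiv counter size_).
Local Notation col_index := (ISub counter (IMul row_index size_)).
Local Notation rank_of e := (ICell (IAdd (ICst 3) e)).
Local Notation square := (IMul size_ size_).

Definition for_loop (bound : iexpr) (body : cmd) : cmd :=
  Seq (ISet (ICst 0) (ICst 0))
    (While (ILt counter bound)
       (Seq body (ISet (ICst 0) (IAdd counter (ICst 1))))).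

(** One loop runs through all matrix positions, row and column being recovered by division. The
    offset [size_] skips the thresholds that precede the weights. *)
Definition add_entries (base : iexpr) (b : test) : cmd :=
  for_loop square
    (If b (NSet (IAdd base row_index)
             (NAdd (NCell (IAdd base row_index)) (NIn (IAdd size_ counter))))
          Skip).

Definition set_candidate : cmd := ISet (ICst 1) (IAdd row_index (ICst 1)).

(* Candidates are shifted by one, 0 meaning that none has been found. *)
Definition find_candidate : cmd :=
  Seq (ISet (ICst 1) (ICst 0))
    (for_loop square
      (If (ILt (ICst 0) (rank_of row_index)) Skip
      (If (NLt (NIn row_index) (NCell row_index))
        (* The offset 1 skips the vertex count; the product is positive iff the edge is present and
           its column vertex is ranked. The fallback below never replaces an earlier candidate. *)
        (If (ILt (ICst 0) (IMul (IIn (IAdd (ICst 1) counter)) (rank_of col_index)))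
           set_candidate
           (If (ILt candidate (ICst 1)) set_candidate Skip))
        set_candidate))).

(** The count is increased before it is stored, so ranks start at 1. Because of the shift of the
    candidate, offset 2 addresses the rank cell of the chosen vertex. *)
Definition rank_vertices : cmd :=
  While (ILt rank_count size_)
    (Seq find_candidate
    (Seq (ISet (ICst 2) (IAdd rank_count (ICst 1)))
         (ISet (IAdd (ICst 2) candidate) rank_count))).

(** Number expressions have no constants, so 0 is written as a difference of equal inputs. *)
Definition write_payments : cmd :=
  for_loop size_
    (If (NLt (NIn counter) (NCell (IAdd size_ counter)))
       (Write (NSub (NIn counter) (NIn counter)))
       (Write (NSub (NIn counter) (NCell (IAdd size_ counter))))).

Definition otvw_program : cmd :=
  Seq (add_entries (ICst 0) (ILt (ICst 0) (ICst 1)))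
  (Seq rank_vertices
  (Seq (add_entries size_ (ILt (rank_of row_index) (rank_of col_index)))
       write_payments)).

(** * Running times *)

Definition is_polynomial (f : nat -> nat) : Prop :=
  exists q : {poly nat}, forall m, f m = q.[m].

Lemma polynomial_const c : is_polynomial (fun=> c).
Proof. by exists c%:P => m; rewrite hornerC. Qed.

Lemma polynomial_id : is_polynomial id.
Proof. by exists 'X => m; rewrite hornerX. Qed.

Lemma polynomialD f g :
  is_polynomial f -> is_polynomial g -> is_polynomial (fun m => f m + g m)%N.
Proof. by move=> [p fE] [q gE]; exists (p + q) => m; rewrite hornerD fE gE. Qed.

Lemma polynomialM f g :
  is_polynomial f -> is_polynomial g -> is_polynomial (fun m => f m * g m)%N.
Proof. by move=> [p fE] [q gE]; exists (p * q) => m; rewrite hornerM fE gE. Qed.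

Lemma polynomialS f : is_polynomial f -> is_polynomial (fun m => (f m).+1).
Proof. by move=> fP; apply: (polynomialD (polynomial_const 1) fP). Qed.

(** The index bounds the number of terms rather than counting it, and an index [i] beyond the list
    contributes 0. *)
Inductive signed_sum (K : zmodType) (xs : seq K) : nat -> K -> Prop :=
  | SignedSum0 k : signed_sum xs k 0
  | SignedSumD k a i : signed_sum xs k a -> signed_sum xs k.+1 (a + xs`_i)
  | SignedSumB k a i : signed_sum xs k a -> signed_sum xs k.+1 (a - xs`_i).

Section SignedSum.
Variables (K : zmodType) (xs : seq K).

Lemma signed_sum_leq k l a :
  (k <= l)%N -> signed_sum xs k a -> signed_sum xs l a.
Proof.
move=> kl aP; elim: aP l kl => {k a} [k|k a i _ IH|k a i _ IH] [|l] // kl.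
- exact: SignedSum0.
- exact: SignedSum0.
- exact/SignedSumD/IH.
- exact/SignedSumB/IH.
Qed.

Lemma signed_sumD k l a b :
  signed_sum xs k a -> signed_sum xs l b -> signed_sum xs (k + l) (a + b).
Proof.
move=> aP; elim=> {l b} [l|l b i _ IH|l b i _ IH].
- by rewrite addr0; apply: signed_sum_leq aP; rewrite leq_addr.
- by rewrite addrA addnS; apply: SignedSumD.
- by rewrite addrA addnS; apply: SignedSumB.
Qed.

Lemma signed_sumN k a : signed_sum xs k a -> signed_sum xs k (- a).
Proof.
elim=> {k a} [k|k a i _ IH|k a i _ IH]; first by rewrite oppr0; exact: SignedSum0.
- by rewrite opprD; apply: SignedSumB.
- by rewrite opprB addrC; apply: SignedSumD.
Qed.

Lemma signed_sum1 i : signed_sum xs 1 xs`_i.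
Proof. by rewrite -[xs`_i]add0r; apply: SignedSumD; apply: SignedSum0. Qed.

Lemma signed_sum_nat (P : pred nat) (f : nat -> nat) j :
  signed_sum xs j (\sum_(0 <= i < j | P i) xs`_(f i)).
Proof.
elim: j => [|j IH]; first by rewrite big_geq //; apply: SignedSum0.
rewrite big_mkcond big_nat_recr //= -big_mkcond; case: (P j); first exact: SignedSumD.
by rewrite addr0; apply: signed_sum_leq IH.
Qed.

End SignedSum.

(** * Syntactic bounds on values, costs and running times *)

Lemma bitlen_leS n : (bitlen n <= n.+1)%N.
Proof.
rewrite /bitlen ltnS; case: n => [|n]; first by rewrite trunc_log0.
have := trunc_logP (isT : 1 < 2)%N (isT : 0 < n.+1)%N.
by have := ltn_expl (trunc_log 2 n.+1) (isT : 1 < 2)%N; lia.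
Qed.

(* [ibound e m] bounds the value of [e] when all integer cells and inputs are
   at most [m], and [nbound] the number of inputs in the signed sum computed
   by a number expression when all number cells are sums of at most [m]. *)
Fixpoint ibound (e : iexpr) (m : nat) : nat :=
  match e with
  | ICst n => n
  | ICell _ | IIn _ => m
  | IAdd a b | ISub a b => ibound a m + ibound b m
  | IMul a b => ibound a m * ibound b m
  | IDiv a b => ibound a m
  end.

Fixpoint icost_bound (e : iexpr) (m : nat) : nat :=
  match e with
  | ICst n => n.+2
  | ICell a | IIn a => icost_bound a m + (ibound a m + m).+3
  | IAdd a b | ISub a b | IMul a b | IDiv a b =>
      icost_bound a m + icost_bound b m + (ibound a m + ibound b m).+3
  end.

Fixpoint nbound (e : nexpr) (m : nat) : nat :=
  match e with
  | NCell _ => m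
  | NIn _ => 1
  | NAdd a b | NSub a b => nbound a m + nbound b m
  end.

Section CostBound.
(* [lenb k m] bounds the length of a signed sum of [k] entries of an input of
   size [m]. *)
Variable lenb : nat -> nat -> nat.

Fixpoint ncost_bound (e : nexpr) (m : nat) : nat :=
  match e with
  | NCell a => icost_bound a m + (ibound a m).+2 + lenb m m
  | NIn a => icost_bound a m + (ibound a m).+2 + lenb 1 m
  | NAdd a b | NSub a b =>
      (ncost_bound a m + ncost_bound b m
         + lenb (nbound a m) m + lenb (nbound b m) m).+1
  end.

Fixpoint tcost_bound (b : test) (m : nat) : nat :=
  match b with
  | ILt a b => icost_bound a m + icost_bound b m + (ibound a m + ibound b m).+3
  | NLt a b =>
      (ncost_bound a m + ncost_bound b m
         + lenb (nbound a m) m + lenb (nbound b m) m).+1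
  | TNot b => (tcost_bound b m).+1
  end.

(** A loop is charged [m] iterations, which is justified by the bound on the measure in
    [wp_while]. *)
Fixpoint time_bound (c : cmd) (m : nat) : nat :=
  match c with
  | Skip => 1
  | ISet a e => icost_bound a m + icost_bound e m + (ibound a m + ibound e m).+3
  | NSet a e =>
      icost_bound a m + ncost_bound e m + (ibound a m).+2 + lenb (nbound e m) m
  | Write e => (ncost_bound e m + lenb (nbound e m) m).+1
  | Seq c1 c2 => (time_bound c1 m + time_bound c2 m).+1
  | If b c1 c2 => (tcost_bound b m + time_bound c1 m + time_bound c2 m).+1
  | While b c =>
      m * (tcost_bound b m + time_bound c m).+1 + (tcost_bound b m).+1
  end.

Hypothesis lenb_poly :
  forall f, is_polynomial f -> is_polynomial (fun m => lenb (f m) m).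

Ltac solve_polynomial :=
  repeat first
    [ assumption | exact: polynomial_const | exact: polynomial_id
    | apply: polynomialS | apply: polynomialD | apply: polynomialM
    | apply: lenb_poly ].

Lemma polynomial_ibound e : is_polynomial (ibound e).
Proof. by elim: e => /= *; solve_polynomial. Qed.

Lemma polynomial_icost_bound e : is_polynomial (icost_bound e).
Proof.
by elim: e => /= *; solve_polynomial; apply: polynomial_ibound.
Qed.

Lemma polynomial_nbound e : is_polynomial (nbound e).
Proof. by elim: e => /= *; solve_polynomial. Qed.

Lemma polynomial_ncost_bound e : is_polynomial (ncost_bound e).
Proof.
by elim: e => /= *; solve_polynomial;
  first [exact: polynomial_icost_bound | exact: polynomial_ibound
        | exact: polynomial_nbound].
Qed.

Lemma polynomial_tcost_bound b : is_polynomial (tcost_bound b).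
Proof.
by elim: b => /= *; solve_polynomial;
  first [exact: polynomial_icost_bound | exact: polynomial_ibound
        | exact: polynomial_nbound | exact: polynomial_ncost_bound].
Qed.

Lemma polynomial_time_bound c : is_polynomial (time_bound c).
Proof.
by elim: c => /= *; solve_polynomial;
  first [exact: polynomial_icost_bound | exact: polynomial_ibound
        | exact: polynomial_nbound | exact: polynomial_ncost_bound
        | exact: polynomial_tcost_bound].
Qed.

End CostBound.

(** * Bit length of signed sums of rationals *)

Lemma bitlen_le_exp2 k n : (n <= 2 ^ k)%N -> (bitlen n <= k.+1)%N.
Proof.
move=> nk; rewrite /bitlen ltnS; case: n nk => [|n] nk; first by rewrite trunc_log0.
by rewrite -(leq_exp2l (m := 2)) //; apply: leq_trans nk; apply: trunc_logP.
Qed.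

Lemma lt_exp2_bitlen n : (n < 2 ^ bitlen n)%N.
Proof. exact: trunc_log_ltn. Qed.

(** Reducing the fraction divides both parts by a nonzero integer, which cannot lengthen them. The 3
    consists of the sign bit and one extra digit for each part. *)
Lemma rat_len_divq_le (p : int) (q k l : nat) :
  (0 < q)%N -> (`|p| <= 2 ^ k)%N -> (q <= 2 ^ l)%N ->
  (rat_len (p%:~R / q%:R) <= k + l + 3)%N.
Proof.
move=> q0 pk ql; rewrite /rat_len -[q%:R]/(q%:Z%:~R).
have : q%:Z != 0 by case: q q0 ql.
move: ql; have -> : (q <= 2 ^ l)%N = (`|q%:Z| <= 2 ^ l)%N by [].
move: (q%:Z) => {q q0} q ql q0; move: pk ql.
case: (divqP p q) q0 => [//|c x c0 _]; rewrite !abszM => pk ql.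
have c1 : (0 < `|c|)%N by rewrite absz_gt0.
have := bitlen_le_exp2 (leq_trans (leq_pmull _ c1) pk).
have := bitlen_le_exp2 (leq_trans (leq_pmull _ c1) ql).
by lia.
Qed.

Definition rat_sum_len (k m : nat) : nat := k * m.+1 + k * m + 3.

(** The induction runs on unreduced fractions with multiplied denominators: each term costs [m] bits
    in the denominator and [m.+1] in the numerator. Only the final fraction is reduced. *)
Lemma rat_len_signed_sum (xs : seq rat) m k a :
  (forall b, b \in xs -> rat_len b <= m)%N ->
  signed_sum xs k a -> (rat_len a <= rat_sum_len k m)%N.
Proof.
move=> xsm aP.
have entry i : (`|numq xs`_i| <= 2 ^ m)%N /\ (`|denq xs`_i| <= 2 ^ m)%N.
  case: (ltnP i (size xs)) => [/(mem_nth 0)/xsm|/(nth_default 0) ->].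
    rewrite /rat_len => le_m; split; apply: ltnW;
      apply: leq_trans (lt_exp2_bitlen _) _; rewrite leq_exp2l //; apply: leq_trans le_m; last exact: leq_addl.
    by rewrite -addnA addnCA leq_addr.
  by split; rewrite ?expn_gt0.
suff [p [q [-> q0 pk qk]]] : exists (p : int) (q : nat),
    [/\ a = p%:~R / q%:R, (0 < q)%N, (`|p| <= 2 ^ (k * m.+1))%N
      & (q <= 2 ^ (k * m))%N] by exact: rat_len_divq_le.
have step k' b i (s : int) : `|s|%N = 1%N ->
  (exists (p : int) (q : nat),
    [/\ b = p%:~R / q%:R, (0 < q)%N, (`|p| <= 2 ^ (k' * m.+1))%N
      & (q <= 2 ^ (k' * m))%N]) ->
  exists (p : int) (q : nat),
    [/\ b + s%:~R * xs`_i = p%:~R / q%:R, (0 < q)%N,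
        (`|p| <= 2 ^ (k'.+1 * m.+1))%N & (q <= 2 ^ (k'.+1 * m))%N].
  move=> s1 [p [q [-> q0 pk qk]]]; have [nm dm] := entry i.
  set n := numq xs`_i in nm *; set d := denq xs`_i in dm *.
  have d0 : (0 < `|d|)%N by rewrite absz_gt0 denq_neq0.
  exists (p * `|d|%:Z + s * n * q%:Z), (q * `|d|)%N; split.
  - rewrite -{1}[xs`_i]divq_num_den -/n -/d.
    have -> : d%:~R = `|d|%:R :> rat by rewrite -[in LHS](@gez0_abs d) // denq_ge0.
    rewrite natrM intrD !intrM -!pmulrn; field.
    by rewrite !pnatr_eq0 -!lt0n q0 d0.
  - by rewrite muln_gt0 q0.
  (* The additional bit pays for adding two cross products, each at most [2 ^ (k' * m.+1 + m)]. *)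
  - have -> : (k'.+1 * m.+1 = (k' * m.+1 + m).+1)%N by lia.
    rewrite expnS mul2n -addnn.
    have absD (y z : int) : (absz (y + z)%R <= absz y + absz z)%N by lia.
    apply: leq_trans (absD _ _) _; rewrite !abszM s1 mul1n !absz_nat expnD.
    rewrite [(absz n * q)%N]mulnC leq_add ?leq_mul //; apply: leq_trans qk _.
    by rewrite leq_exp2l // leq_mul2l leqnSn orbT.
  - by rewrite mulSn addnC expnD leq_mul.
elim: aP => {k a} [k|k b i _ IH|k b i _ IH].
- by exists 0, 1%N; split; rewrite ?mul0r ?expn_gt0.
- by rewrite -[xs`_i]mul1r; apply: (step k b i 1).
- by rewrite -mulN1r; apply: (step k b i (-1)).
Qed.

Lemma polynomial_rat_sum_len f :
  is_polynomial f -> is_polynomial (fun m => rat_sum_len (f m) m).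
Proof.
move=> fP; apply: polynomialD; last exact: polynomial_const.
by apply: polynomialD; apply: polynomialM => //; 
  [apply: polynomialS|]; exact: polynomial_id.
Qed.

(** * Correctness of the program *)

(** Row [v] occupies the positions from [v * n] up to, but excluding, [v.+1 * n]. *)
Lemma sum_row (K : nmodType) (n v : nat) (P : pred nat) (F : nat -> K) :
  (v < n)%N ->
  \sum_(0 <= i < n * n | (i %/ n == v)%N && P i) F i =
  \sum_(0 <= u < n | P (v * n + u)%N) F (v * n + u)%N.
Proof.
move=> vn; have n0 : (0 < n)%N by lia.
have le1 : (v * n <= v.+1 * n)%N by rewrite leq_mul2r leqnSn orbT.
have le2 : (v.+1 * n <= n * n)%N by rewrite leq_mul2r vn orbT.
have le3 := leq_trans le1 le2.
rewrite (big_cat_nat (n := v.+1 * n)) //= (big_cat_nat (n := v * n)) //=.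
rewrite [X in X + _ + _]big_nat_cond big_pred0 ?add0r => [|i]; last first.
  apply/negP => /and3P[/andP[_ vi] /eqP iv _].
  by move: vi; rewrite -iv ltnNge leq_trunc_div.
rewrite [X in _ + X]big_nat_cond [X in _ + X]big_pred0 ?addr0 => [|i]; last first.
  apply/negP => /and3P[/andP[vi _] /eqP iv _].
  by move: vi; rewrite -leq_divRL // iv ltnn.
rewrite mulSn -{1}[(v * n)%N]add0n big_addn addnK big_nat_cond [RHS]big_nat_cond.
apply: eq_big => [u|u _]; last by rewrite addnC.
by case: ltnP => //= un; rewrite addnC divnMDl // divn_small // addn0 eqxx.
Qed.

(** * A program logic for total correctness with time bounds *)

Section Wp.
Variables (K : realFieldType) (len : K -> nat) (lenb : nat -> nat -> nat).
Variables (x : input K) (m : nat).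
Hypothesis iinput_le : forall i, (nth 0%N (iinput x) i <= m)%N.
Hypothesis len_le : forall k a, signed_sum (ninput x) k a -> (len a <= lenb k m)%N.

Definition bounded (s : state K) : Prop :=
  (forall a, icell s a <= m)%N /\ (forall a, signed_sum (ninput x) m (ncell s a)).

Lemma bounded_init : bounded (init_state K).
Proof. by split=> //= _; apply: SignedSum0. Qed.

Section Bounds.
Variables (s : state K).
Hypothesis sB : bounded s.

Lemma ival_le e : (ival x s e <= ibound e m)%N.
Proof.
case: sB => sI _; elim: e => //= a IHa b IHb.
- by rewrite leq_add.
- by apply: leq_trans (leq_subr _ _) _; apply: leq_trans IHa (leq_addr _ _).
- by rewrite leq_mul.
- by apply: leq_trans (leq_div _ _) IHa.
Qed.

Lemma bitlen_ival_le e : (bitlen (ival x s e) <= (ibound e m).+1)%N.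
Proof. by apply: leq_trans (bitlen_leS _) _; rewrite ltnS ival_le. Qed.

Lemma icost_le e : (icost x s e <= icost_bound e m)%N.
Proof.
elim: e => [n|a IHa|a IHa|a IHa b IHb|a IHa b IHb|a IHa b IHb|a IHa b IHb] /=.
- by have := bitlen_leS n; lia.
- by have := bitlen_ival_le a; have := bitlen_ival_le (ICell a); rewrite /=; lia.
- by have := bitlen_ival_le a; have := bitlen_ival_le (IIn a); rewrite /=; lia.
all: by have := bitlen_ival_le a; have := bitlen_ival_le b; lia.
Qed.

Lemma nval_signed_sum e : signed_sum (ninput x) (nbound e m) (nval x s e).
Proof.
case: sB => _ sN; elim: e => //= [a|a IHa b IHb|a IHa b IHb].
- exact: signed_sum1.
- exact: signed_sumD.
- exact/signed_sumD/signed_sumN.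
Qed.

Lemma len_nval_le e : (len (nval x s e) <= lenb (nbound e m) m)%N.
Proof. exact/len_le/nval_signed_sum. Qed.

Lemma ncost_le e : (ncost len x s e <= ncost_bound lenb e m)%N.
Proof.
elim: e => [a|a|a IHa b IHb|a IHa b IHb] /=.
- by have := bitlen_ival_le a; have := icost_le a; have := len_nval_le (NCell a);
    rewrite /=; lia.
- by have := bitlen_ival_le a; have := icost_le a; have := len_nval_le (NIn a);
    rewrite /=; lia.
all: by have := len_nval_le a; have := len_nval_le b; lia.
Qed.

Lemma tcost_le b : (tcost len x s b <= tcost_bound lenb b m)%N.
Proof.
elim: b => [a b|a b|b IHb] /=; last by rewrite add1n ltnS.
- by have := bitlen_ival_le a; have := bitlen_ival_le b; have := icost_le a;
    have := icost_le b; lia.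
- by have := len_nval_le a; have := len_nval_le b; have := ncost_le a;
    have := ncost_le b; lia.
Qed.

End Bounds.

(** The time bound and the preservation of [bounded] are built in, so that a proof about a program
    only has to bound the assigned values and the loop measures. *)
Definition wp (c : cmd) (Q : state K -> Prop) (s : state K) : Prop :=
  bounded s -> exists (t : nat) (s' : state K),
    [/\ exec len x c s t s', (t <= time_bound lenb c m)%N, bounded s' & Q s'].

Lemma wp_impl c (Q Q' : state K -> Prop) s :
  (forall s', Q s' -> Q' s') -> wp c Q s -> wp c Q' s.
Proof.
by move=> QQ' H /H[t [s' [? ? ? /QQ' ?]]]; exists t, s'.
Qed.

Lemma wp_skip (Q : state K -> Prop) s : Q s -> wp Skip Q s.
Proof. by move=> Qs sB; exists 1%N, s; split=> //; apply: ExecSkip. Qed.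

Lemma wp_iset a e (Q : state K -> Prop) s :
  (ival x s e <= m)%N ->
  Q (State [eta icell s with ival x s a |-> ival x s e] (ncell s) (output s)) ->
  wp (ISet a e) Q s.
Proof.
move=> em Qs sB.
exists (1 + icost x s a + icost x s e
          + bitlen (ival x s a) + bitlen (ival x s e))%N; eexists; split=> //.
- exact: ExecISet.
- by have := bitlen_ival_le sB a; have := bitlen_ival_le sB e;
    have := icost_le sB a; have := icost_le sB e; rewrite /=; lia.
- by case: sB => sI sN; split=> b //=; case: ifP => _; rewrite ?em.
- exact: Qs.
Qed.

Lemma wp_nset a e (Q : state K -> Prop) s :
  signed_sum (ninput x) m (nval x s e) ->
  Q (State (icell s) [eta ncell s with ival x s a |-> nval x s e] (output s)) ->
  wp (NSet a e) Q s.
Proof.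
move=> em Qs sB.
exists (1 + icost x s a + ncost len x s e
          + bitlen (ival x s a) + len (nval x s e))%N; eexists; split=> //.
- exact: ExecNSet.
- by have := bitlen_ival_le sB a; have := len_nval_le sB e;
    have := icost_le sB a; have := ncost_le sB e; rewrite /=; lia.
- by case: sB => sI sN; split=> b //=; case: ifP => _; rewrite ?em.
- exact: Qs.
Qed.

Lemma wp_write e (Q : state K -> Prop) s :
  Q (State (icell s) (ncell s) (rcons (output s) (nval x s e))) ->
  wp (Write e) Q s.
Proof.
move=> Qs sB; exists (1 + ncost len x s e + len (nval x s e))%N.
eexists; split; [exact: ExecWrite | | exact: sB | exact: Qs].
by have := len_nval_le sB e; have := ncost_le sB e; rewrite /=; lia.
Qed.

Lemma wp_seq c1 c2 Q s : wp c1 (wp c2 Q) s -> wp (Seq c1 c2) Q s.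
Proof.
move=> H /H[t1 [s1 [e1 t1le s1B /(_ s1B)[t2 [s2 [e2 t2le s2B Qs2]]]]]].
exists (1 + t1 + t2)%N, s2; split=> //; first exact: ExecSeq e1 e2.
by rewrite /=; lia.
Qed.

Lemma wp_if b c1 c2 Q s :
  (Defs.tval x s b -> wp c1 Q s) -> (~~ Defs.tval x s b -> wp c2 Q s) ->
  wp (If b c1 c2) Q s.
Proof.
move=> H1 H2 sB; have tle := tcost_le sB b.
have [t [s' [et tle' s'B Qs']]] : exists (t : nat) (s' : state K),
    [/\ exec len x (if Defs.tval x s b then c1 else c2) s t s',
        (t <= time_bound lenb c1 m + time_bound lenb c2 m)%N,
        bounded s' & Q s'].
  case: (boolP (Defs.tval x s b)) => [/H1|/H2] /(_ sB)[t [s' [? ? ? ?]]];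
    by exists t, s'; split=> //; lia.
exists (1 + tcost len x s b + t)%N, s'; split=> //; first exact: ExecIf.
by rewrite /=; lia.
Qed.

(** The measure gives termination and, starting at no more than [m], also the number of iterations
    allowed by [time_bound]. *)
Lemma wp_while b c (Inv : state K -> Prop) (mu : state K -> nat)
    (Q : state K -> Prop) s :
  (forall s, Inv s -> Defs.tval x s b ->
     wp c (fun s' => Inv s' /\ (mu s' < mu s)%N) s) ->
  (forall s, Inv s -> ~~ Defs.tval x s b -> Q s) ->
  Inv s -> (mu s <= m)%N -> wp (While b c) Q s.
Proof.
move=> step final sI0 mu0.
suff H k s1 : Inv s1 -> (mu s1 <= k)%N -> bounded s1 ->
    exists (t : nat) (s' : state K), [/\ exec len x (While b c) s1 t s',
      (t <= k * (tcost_bound lenb b m + time_bound lenb c m).+1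
              + (tcost_bound lenb b m).+1)%N,
      bounded s' & Q s'] by exact: H.
elim: k s1 => [|k IH] {sI0 mu0}s sI muk sB; have tle := tcost_le sB b;
  case: (boolP (Defs.tval x s b)) => [bT|bF].
- by have [t [s' [_ _ _ []]]] := step s sI bT sB; lia.
- exists (1 + tcost len x s b)%N, s; split=> //; first exact: ExecWhileDone.
  exact: final.
- have [t1 [s1 [e1 t1le s1B [s1I mu1]]]] := step s sI bT sB.
  have mu1k : (mu s1 <= k)%N by lia.
  have [t2 [s2 [e2 t2le s2B Qs2]]] := IH s1 s1I mu1k s1B.
  exists (1 + tcost len x s b + t1 + t2)%N, s2; split=> //.
    exact: ExecWhileStep bT e1 e2.
  by rewrite mulSn; lia.
- exists (1 + tcost len x s b)%N, s; split=> //; first exact: ExecWhileDone.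
  + by rewrite mulSn; lia.
  + exact: final.
Qed.

(** * The program run on an input in matrix form *)

Local Notation n := (nth 0%N (iinput x) 0).
Hypothesis square_lt : (n * n < m)%N.

Definition thr (v : nat) : K := (ninput x)`_v.
Definition entry (i : nat) : K := (ninput x)`_(n + i).
Definition link (v u : nat) : bool := (0 < nth 0%N (iinput x) (v * n + u).+1)%N.
Definition row_sum (v : nat) : K := \sum_(0 <= u < n) entry (v * n + u).
Definition full (v : nat) : bool := ~~ (thr v < row_sum v).
Definition higher_sum (r : nat -> nat) (v : nat) : K :=
  \sum_(0 <= u < n | (r v < r u)%N) entry (v * n + u).

Let n_le : (n <= m)%N. Proof. exact: iinput_le. Qed.

Let row_lt j : (j < n * n -> j %/ n < n)%N.
Proof. by case: n => [|k] jn; rewrite ?ltn_divLR. Qed.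

Let col_lt j : (j < n * n -> j %% n < n)%N.
Proof. by case: n => [|k] jn; rewrite ?ltn_mod. Qed.

Let sub_div j : (j - j %/ n * n = j %% n)%N.
Proof. by rewrite {1}(divn_eq j n) addKn. Qed.

Let pair_lt v u : (v < n -> u < n -> v * n + u < n * n)%N.
Proof.
move=> vn un; apply: (@leq_trans (v.+1 * n)); last by rewrite leq_mul2r vn orbT.
by rewrite mulSn addnC ltn_add2r.
Qed.

Let pair_div v u : (u < n -> (v * n + u) %/ n = v)%N.
Proof.
by move=> un; rewrite divnMDl ?divn_small ?addn0 //; apply: leq_ltn_trans un.
Qed.

Let pair_mod v u : (u < n -> (v * n + u) %% n = u)%N.
Proof. by move=> un; rewrite modnMDl modn_small. Qed.

Definition set_counter (s : state K) (j : nat) : state K :=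
  State [eta icell s with 0%N |-> j] (ncell s) (output s).

(** The body has to leave the counter unchanged; the invariant for [j.+1] is asked of the state
    after the increment made by the loop itself. *)
Lemma wp_for bound N body (I : nat -> state K -> Prop) (Q : state K -> Prop) s :
  (forall s, ival x s bound = N) -> (N < m)%N ->
  I 0%N (set_counter s 0) ->
  (forall j s, (j < N)%N -> icell s 0 = j -> I j s ->
     wp body (fun s' => icell s' 0 = j /\ I j.+1 (set_counter s' j.+1)) s) ->
  (forall s, I N s -> Q s) ->
  wp (for_loop bound body) Q s.
Proof.
move=> boundE Nm I0 step final.
apply: wp_seq; apply: wp_iset => //=.
apply: (wp_while (Inv := fun s => (icell s 0 <= N)%N /\ I (icell s 0) s)
                 (mu := fun s => N - icell s 0)%N) => //=.
- move=> s1 [_ Ij]; rewrite boundE => jN.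
  apply: wp_seq; apply: wp_impl (step _ _ jN erefl Ij) => s' [jE Ij'].
  apply: wp_iset => /=; rewrite jE addn1; first lia.
  by split; [split|]; rewrite //; lia.
- move=> s1 [jN Ij]; rewrite boundE -leqNgt => Nj; apply: final.
  by have <- : icell s1 0 = N by lia.
- by rewrite subn0 ltnW.
Qed.

(** Since the cells from [B] on start at 0, each updated cell holds a plain sum of at most [n * n]
    inputs, which keeps the state bounded. *)
Lemma wp_add_entries base b B (cond : pred nat) s0 :
  (forall s, ival x s base = B) ->
  (forall j s, (j < n * n)%N -> icell s 0 = j ->
     (forall z, icell s z.+1 = icell s0 z.+1) -> Defs.tval x s b = cond j) ->
  (forall z, (B <= z)%N -> ncell s0 z = 0) ->
  wp (add_entries base b)
    (fun s => [/\ forall z, icell s z.+1 = icell s0 z.+1, output s = output s0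
      & forall z, ncell s z = ncell s0 z
          + \sum_(0 <= i < n * n | (B + i %/ n == z)%N && cond i) entry i]) s0.
Proof.
move=> baseE bE s00.
apply: (@wp_for _ (n * n)%N _ (fun j s =>
  [/\ forall z, icell s z.+1 = icell s0 z.+1, output s = output s0
    & forall z, ncell s z = ncell s0 z
        + \sum_(0 <= i < j | (B + i %/ n == z)%N && cond i) entry i])) => //.
  by split=> // z; rewrite big_geq ?addr0.
move=> j s jn sj [sI sO sN].
have sumS z : \sum_(0 <= i < j.+1 | (B + i %/ n == z)%N && cond i) entry i =
    \sum_(0 <= i < j | (B + i %/ n == z)%N && cond i) entry i
    + (if (B + j %/ n == z)%N && cond j then entry j else 0).
  by rewrite big_mkcond big_nat_recr //= -big_mkcond.
apply: wp_if; rewrite (bE j) // => jc; last first.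
  apply: wp_skip; split=> //; split=> //= z.
  by rewrite sN sumS (negPf jc) andbF addr0.
have cellE : nval x s (NAdd (NCell (IAdd base row_index)) (NIn (IAdd size_ counter)))
    = \sum_(0 <= i < j.+1 | (B + i %/ n == B + j %/ n)%N && cond i) entry i.
  by rewrite sumS eqxx jc /= baseE sj sN s00 ?add0r // leq_addr.
apply: wp_nset; rewrite cellE.
  apply: signed_sum_leq (signed_sum_nat _ _ (fun i => n + i)%N _).
  exact: leq_trans jn (ltnW square_lt).
split=> //; split=> //= z; rewrite baseE sj.
case: eqP => [->|/eqP zN]; first by rewrite s00 ?leq_addr // add0r.
by rewrite sN sumS eq_sym (negPf zN) addr0.
Qed.

Definition rank (s : state K) (v : nat) : nat := icell s v.+3.

Lemma wp_find_candidate s0 :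
  (forall v, (v < n)%N -> ncell s0 v = row_sum v) ->
  (exists2 v, (v < n)%N & rank s0 v = 0%N) ->
  wp find_candidate
    (fun s => [/\ forall z, icell s z.+2 = icell s0 z.+2, output s = output s0,
                  ncell s = ncell s0
      & exists a, [/\ icell s 1 = a.+1, (a < n)%N, rank s0 a = 0%N
        & [\/ full a, reachable n link (rank s0) a
          | forall v, (v < n)%N -> rank s0 v = 0%N ->
              ~~ full v /\ ~ reachable n link (rank s0) v]]]) s0.
Proof.
move=> rowE [v0 v0n rv0].
pose ok i := full (i %/ n) || link (i %/ n) (i %% n) && picked (rank s0) (i %% n).
(* A stored candidate is either a preferred vertex or a fallback, the latter only if no scanned
   position has shown a preferred unranked vertex. *)
pose Inv j s := [/\ forall z, icell s z.+2 = icell s0 z.+2, output s = output s0,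
   ncell s = ncell s0
   & if icell s 1 is a.+1 then
       [/\ (a < n)%N, rank s0 a = 0%N
         & (full a \/ reachable n link (rank s0) a)
           \/ forall i, (i < j)%N -> rank s0 (i %/ n) = 0%N -> ~~ ok i]
     else forall i, (i < j)%N -> rank s0 (i %/ n) <> 0%N].
apply: wp_seq; apply: wp_iset => //=.
apply: (@wp_for _ (n * n)%N _ Inv) => // [j s jn sj|s].
  case=> sI sO sN cand.
  (* With no candidate stored so far, all scanned rows belong to ranked vertices, so storing a
     fallback overlooks nothing. *)
  have set_cand : rank s0 (j %/ n) = 0%N ->
      (ok j \/ icell s 1 = 0%N) ->
      wp set_candidate
        (fun s' => icell s' 0 = j /\ Inv j.+1 (set_counter s' j.+1)) s.
    move=> rj okj; apply: wp_iset; rewrite /= sj addn1.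
      by apply: leq_trans (row_lt jn) n_le.
    split=> //; split=> //=; split; rewrite ?row_lt //.
    case: okj => [/orP[jF|/andP[jl jp]]|c0]; first by left; left.
      by left; right; exists (j %% n)%N; rewrite ?col_lt // jl.
    move: cand; rewrite c0 => cand.
    case: (boolP (ok j)) => [/orP[jF|/andP[jl jp]]|okj]; first by left; left.
      by left; right; exists (j %% n)%N; rewrite ?col_lt // jl.
    right=> i; rewrite ltnS leq_eqVlt => /orP[/eqP -> //|ij ri].
    by case: (cand i ij).
  have keep : (rank s0 (j %/ n) = 0%N -> ~~ ok j /\ icell s 1 <> 0%N) ->
      wp Skip (fun s' => icell s' 0 = j /\ Inv j.+1 (set_counter s' j.+1)) s.
    move=> jP; apply: wp_skip; split=> //; split=> //=.
    move: cand jP; case: (icell s 1) => [|a] cand jP.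
      by move=> i; rewrite ltnS leq_eqVlt => /orP[/eqP -> /jP[]|/cand].
    case: cand => an ra aP; split=> //; case: aP => [|aP]; [by left|right].
    move=> i; rewrite ltnS leq_eqVlt => /orP[/eqP -> /jP[]|/aP] //.
  have rankE v : icell s (3 + v)%N = rank s0 v by rewrite sI.
  apply: wp_if; rewrite /= sj rankE => rj; first by apply: keep; lia.
  move: rj; rewrite -eqn0Ngt => /eqP rj.
  apply: wp_if => /=; rewrite sj sN rowE ?row_lt // => jF; last first.
    by apply: set_cand => //; left; rewrite /ok /full jF.
  have okE : ok j = (0 < nth 0 (iinput x) (1 + j) * rank s0 (j %% n))%N.
    by rewrite /ok /full jF /= /link -divn_eq muln_gt0.
  apply: wp_if => /=; rewrite sj sub_div rankE -okE => okj.
    by apply: set_cand => //; left.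
  apply: wp_if => /= c0.
    by move: c0; rewrite ltnS leqn0 => /eqP c0; apply: set_cand => //; right.
  by apply: keep => _; split=> // c; rewrite c in c0.
case=> sI sO sN cand; split=> //.
(* As there is a column, every vertex owns a scanned position: a candidate has been found, and every
   unranked vertex has been examined. *)
have n0 : (0 < n)%N by lia.
move: cand; case: (icell s 1) => [|a].
  by move/(_ (v0 * n + 0)%N (pair_lt v0n n0)); rewrite pair_div.
case=> an ra aP; exists a; split=> //.
case: aP => [[]|aP]; [by constructor 1|by constructor 2|constructor 3].
move=> v vn rv.
have okN u : (u < n)%N -> ~~ (full v || link v u && picked (rank s0) u).
  move=> un; have := aP _ (pair_lt vn un).
  by rewrite /ok pair_div // pair_mod //; apply.
split; first by have := okN 0%N n0; rewrite negb_or => /andP[].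
by case=> u /okN; rewrite negb_or => /andP[_ /negPf ->].
Qed.

Lemma wp_rank_vertices s0 :
  (forall v, (v < n)%N -> ncell s0 v = row_sum v) ->
  (forall z, icell s0 z.+1 = 0%N) ->
  wp rank_vertices
    (fun s => [/\ output s = output s0, ncell s = ncell s0
      & partial_rank n full link n (rank s)]) s0.
Proof.
move=> rowE s00.
apply: (wp_while (Inv := fun s => [/\ output s = output s0, ncell s = ncell s0,
            (icell s 2 <= n)%N & partial_rank n full link (icell s 2) (rank s)])
          (mu := fun s => n - icell s 2)%N) => //=; last by rewrite s00 subn0.
- move=> s [sO sN cn rP] {}cn.
  have rU := partial_rank_unpicked rP cn.
  apply: wp_seq; apply: wp_impl (wp_find_candidate _ rU); last by rewrite sN.
  move=> s1 [s1I s1O s1N [a [ca an ra aP]]].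
  apply: wp_seq; apply: wp_iset => /=; rewrite s1I addn1; first by lia.
  apply: wp_iset => /=; first by lia.
  rewrite ca add2n /=; split; last by lia.
  split=> //=; [by rewrite s1O|by rewrite s1N|].
  apply: partial_rankS rP an ra _ aP => v /=.
  by rewrite /rank /= s1I.
- move=> s [sO sN cn rP]; rewrite -leqNgt => nc; split=> //.
  by move: rP; have -> : icell s 2 = n by lia.
- by split=> //; rewrite s00 //; apply: partial_rank0 => v; apply: s00.
Qed.

Definition pay (r : nat -> nat) (v : nat) : K :=
  if thr v < higher_sum r v then 0 else thr v - higher_sum r v.

Lemma wp_write_payments r s0 :
  (forall v, (v < n)%N -> ncell s0 (n + v) = higher_sum r v) ->
  wp write_payments
    (fun s => output s = output s0 ++ [seq pay r v | v <- iota 0 n]) s0.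
Proof.
move=> cellE.
have nm : (n < m)%N by case: n square_lt => // k; nia.
apply: (@wp_for _ n _ (fun j s => ncell s = ncell s0 /\
  output s = output s0 ++ [seq pay r v | v <- iota 0 j])) => //.
- by rewrite cats0.
- move=> j s jn sj [sN sO].
  apply: wp_if; rewrite [Defs.tval _ _ _]/= sj sN cellE // => jP; apply: wp_write;
    (split; [exact: sj|split; [exact: sN|]]);
    rewrite -[j.+1]addn1 iotaD map_cat catA /= cats1 sO sj; congr rcons.
  + by rewrite /pay jP subrr.
  + by rewrite /pay (negPf jP) sN cellE.
- by move=> s [].
Qed.

Lemma wp_otvw_program :
  wp otvw_program
    (fun s => exists2 r, partial_rank n full link n r
                       & output s = [seq pay r v | v <- iota 0 n])
    (init_state K).
Proof.
(* Row indices are below [n], so the first pass leaves the cells from [n] on at 0, as the second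
   pass requires. *)
have out0 z : (n <= z)%N ->
    \sum_(0 <= i < n * n | (0 + i %/ n == z)%N && predT i) entry i = 0.
  move=> nz; rewrite big_nat_cond big_pred0 // => i.
  apply/negP => /and3P[/row_lt + /eqP iz _].
  by rewrite -iz in nz *; rewrite ltnNge nz.
apply: wp_seq; apply: wp_impl (@wp_add_entries _ _ 0%N predT _ _ _ _) => //=.
move=> s1 [s1I s1O s1N].
have s1row v : (v < n)%N -> ncell s1 v = row_sum v.
  by move=> vn; rewrite s1N add0r /= sum_row.
apply: wp_seq; apply: wp_impl (wp_rank_vertices s1row s1I) => s2 [s2O s2N rP].
apply: wp_seq.
apply: wp_impl (@wp_add_entries _ _ n
  (fun j => rank s2 (j %/ n) < rank s2 (j %% n))%N _ _ _ _) => //.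
- move=> s3 [s3I s3O s3N].
  apply: wp_impl (@wp_write_payments (rank s2) _ _) => [s4 s4O|v vn].
    by exists (rank s2); rewrite // s4O s3O s2O s1O.
  rewrite s3N s2N s1N out0 ?leq_addr // addr0 add0r.
  under eq_bigl do rewrite eqn_add2l.
  rewrite sum_row // /higher_sum big_nat_cond [RHS]big_nat_cond.
  by apply: eq_bigl => u; case: ltnP => //= un; rewrite pair_div // pair_mod.
- by move=> j s jn sj sI; rewrite /= sj sub_div /rank -!sI.
- by move=> z nz; rewrite s2N s1N add0r out0.
Qed.

End Wp.

(** * Reading the graph off its encoding *)

Lemma nth_allpairs (S T U : Type) (f : S -> T -> U) s t x0 y0 z0 i j k :
  size t = k -> (i < size s)%N -> (j < k)%N ->
  nth z0 [seq f x y | x <- s, y <- t] (i * k + j) = f (nth x0 s i) (nth y0 t j).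
Proof.
move=> <-; elim: s i => [|x s IH] [|i] //= si tj; rewrite nth_cat size_map.
  by rewrite tj (nth_map y0).
by rewrite ifN -?leqNgt mulSn -addnA ?leq_addr // addKn IH.
Qed.

Lemma map_enum_rank (T : finType) :
  [seq val (enum_rank v) | v <- enum T] = iota 0 #|T|.
Proof.
apply: (@eq_from_nth _ 0%N) => [|i]; rewrite size_map -cardE ?size_iota // => iT.
have x0 := enum_val (Ordinal iT).
rewrite (nth_map x0) -?cardE // nth_iota // add0n.
by rewrite -[i in nth _ _ i]/(val (Ordinal iT)) -enum_val_nth enum_valK.
Qed.

Lemma leq_sum_seq (T : eqType) (s : seq T) (f : T -> nat) a :
  a \in s -> (f a <= \sum_(b <- s) f b)%N.
Proof. by move=> sa; rewrite (big_rem a) //= leq_addr. Qed.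

Section Encoding.
Variables (K : realFieldType) (G : ewgraph K).
Implicit Types (u v : vertex G).

Let x := encode G.

Lemma nth_encode_adj u v :
  nth 0%N (iinput x) (enum_rank u * #|vertex G| + enum_rank v).+1 = adj u v.
Proof.
rewrite /= (nth_allpairs _ u u _ (esym (cardE _))) -?cardE //.
by rewrite -!enum_val_nth !enum_rankK.
Qed.

Lemma nth_encode_threshold v : (ninput x)`_(enum_rank v) = threshold v.
Proof.
rewrite /= nth_cat size_map -cardE ltn_ord (nth_map v) -?cardE //.
by rewrite -enum_val_nth enum_rankK.
Qed.

Lemma nth_encode_weight u v :
  (ninput x)`_(#|vertex G| + (enum_rank u * #|vertex G| + enum_rank v)) =
  adj_weight u v.
Proof.
rewrite /= nth_cat size_map -cardE ifN -?leqNgt ?leq_addr // addKn.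
rewrite (nth_allpairs _ u u _ (esym (cardE _))) -?cardE //.
by rewrite -!enum_val_nth !enum_rankK.
Qed.

Lemma sum_enum_rank (P : pred nat) (F : nat -> K) :
  \sum_(0 <= i < #|vertex G| | P i) F i =
  \sum_(v : vertex G | P (enum_rank v)) F (enum_rank v).
Proof.
by rewrite big_mkord (reindex _ (onW_bij _ (@enum_rank_bij (vertex G)))).
Qed.

Lemma row_sum_encode v : row_sum x (enum_rank v) = degree v.
Proof.
rewrite /row_sum sum_enum_rank; apply: eq_bigr => u _.
exact: nth_encode_weight.
Qed.

Lemma higher_sum_encode r v :
  higher_sum x r (enum_rank v) = above (r \o enum_rank) v.
Proof.
rewrite /higher_sum sum_enum_rank; apply: eq_bigr => u _.
exact: nth_encode_weight.
Qed.

Lemma pay_encode r v :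
  pay x r (enum_rank v) = rank_payment (r \o enum_rank) v.
Proof. by rewrite /pay higher_sum_encode /thr nth_encode_threshold. Qed.

Lemma full_encode v : full x (enum_rank v) = ~~ discounted v.
Proof. by rewrite /full row_sum_encode /thr nth_encode_threshold. Qed.

Lemma link_encode u v : link x (enum_rank u) (enum_rank v) = adj u v.
Proof. by rewrite /link nth_encode_adj; case: adj. Qed.

(** Once every vertex is picked, the provisos about picked vertices hold automatically and
    [isolated] becomes [isolated_in_rank]. *)
Lemma greedy_rank_encode r :
  partial_rank #|vertex G| (full x) (link x) #|vertex G| r ->
  greedy_rank (fun v => r (enum_rank v)).
Proof.
move=> rP; have rpos v : picked r (enum_rank v).
  exact: partial_rank_picked rP (ltn_ord _).
have [_ _ rI rG] := rP; split=> [u v uv|v].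
  exact/enum_rank_inj/val_inj/(rI _ _ (ltn_ord _) (ltn_ord _) (rpos u) uv).
case: (rG _ (ltn_ord (enum_rank v)) (rpos v)) => [|[i il]|vI].
- by rewrite full_encode; constructor 1.
- rewrite -[i]/(val (Ordinal il)) -[Ordinal il]enum_valK; set u := enum_val _.
  by rewrite link_encode => /and3P[vu _ ruv]; constructor 2; exists u.
- constructor 3 => u uv.
  have [|gu uI] := vI _ (ltn_ord (enum_rank u)); first by [].
  rewrite full_encode negbK in gu; split=> // w uw.
  by apply: uI => //; rewrite link_encode.
Qed.

End Encoding.

(** Each of the [1 + n * n] integers of the input, [n] being the number of vertices, has at least
    one binary digit. *)
Lemma input_size_ge (K : realFieldType) (len : K -> nat) (G : ewgraph K) :
  (#|vertex G| * #|vertex G| < input_size len (encode G))%N.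
Proof.
apply: leq_trans (leq_addr _ _).
apply: (@leq_trans (size (iinput (encode G)))).
  by rewrite /= size_allpairs -cardE.
by rewrite -sum1_size; apply: leq_sum.
Qed.

Lemma nth_iinput_le (K : realFieldType) (len : K -> nat) (G : ewgraph K) i :
  (nth 0%N (iinput (encode G)) i <= input_size len (encode G))%N.
Proof.
have sz := input_size_ge len G.
case: i => [|i] /=.
  case: (posnP #|vertex G|) => [-> //|n0].
  exact: leq_trans (leq_pmulr _ n0) (ltnW sz).
apply: leq_trans (leq_ltn_trans (leq0n _) sz).
have [lt|ge] := ltnP i (size (behead (iinput (encode G)))); last first.
  by rewrite /= nth_default.
have := mem_nth 0%N lt; rewrite /= => /allpairsP[p [_ _ ->]]; exact: leq_b1.
Qed.

Lemma otvw_program_correct (K : realFieldType) (len : K -> nat)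
    (lenb : nat -> nat -> nat) (G : ewgraph K) :
  (forall xs m k a, (forall b, b \in xs -> len b <= m)%N ->
     signed_sum xs k a -> (len a <= lenb k m)%N) ->
  exists (t : nat) (s : state K),
    [/\ exec len (encode G) otvw_program (init_state K) t s,
        (t <= time_bound lenb otvw_program (input_size len (encode G)))%N
      & exists2 rk : vertex G -> nat, greedy_rank rk
          & output s = [seq rank_payment rk v | v <- enum (vertex G)]].
Proof.
move=> len_le; set m := input_size _ _.
have entry_le b : b \in ninput (encode G) -> (len b <= m)%N.
  by move=> bx; apply: leq_trans (leq_addl _ _); apply: leq_sum_seq.
have [t [s [es tm _ [r rP out]]]] := wp_otvw_program (nth_iinput_le len G)
  (fun k a => len_le _ _ k a entry_le) (input_size_ge len G) (bounded_init _ _).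
exists t, s; split=> //; exists (r \o enum_rank); first exact: greedy_rank_encode.
rewrite out -map_enum_rank -map_comp; apply: eq_map => v; exact: pay_encode.
Qed.

Section MinWeight.
Variables (K : realFieldType) (G : ewgraph K).

Lemma min_weight_ge0 : 0 <= min_weight G.
Proof.
rewrite /min_weight; case: pickP => // e eG.
by apply: le_bigmin => [|f fG]; apply: weight_ge0.
Qed.

Lemma min_weight_le e : e \in edges G -> min_weight G <= weight e.
Proof.
rewrite /min_weight; case: pickP => [e0 _|-> //] eG.
exact: bigmin_le_cond.
Qed.

End MinWeight.

(** * Transfer of rankings and payments along the ordered field embedding [ratr] *)

Section RealGraph.
Variables (R : realType) (G : ewgraph rat).
Local Notation GR := (real_ewgraph R G).
Implicit Types (u v : vertex G) (rk : vertex G -> nat).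

Lemma adj_weight_real u v : @adj_weight R GR u v = ratr (adj_weight u v).
Proof. by rewrite /adj_weight /adj /=; case: ifP; rewrite ?rmorph0. Qed.

Lemma degree_real v : @degree R GR v = ratr (degree v).
Proof.
by rewrite /degree rmorph_sum; apply: eq_bigr => u _; apply: adj_weight_real.
Qed.

Lemma above_real rk v : @above R GR rk v = ratr (above rk v).
Proof.
by rewrite /above rmorph_sum; apply: eq_bigr => u _; apply: adj_weight_real.
Qed.

Lemma discounted_real v : @discounted R GR v = discounted v.
Proof. by rewrite /discounted degree_real ltr_rat. Qed.

Lemma rank_payment_real rk v : @rank_payment R GR rk v = ratr (rank_payment rk v).
Proof.
rewrite /rank_payment above_real ltr_rat.
by case: ifP => _; rewrite ?rmorph0 ?rmorphB.
Qed.

Lemma greedy_rank_real rk : greedy_rank rk -> @greedy_rank R GR rk.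
Proof.
case=> rkI rkG; split=> // v; rewrite discounted_real.
case: (rkG v) => [|[u]|vI]; [by constructor 1|by constructor 2; exists u|].
by constructor 3 => u /vI; rewrite discounted_real.
Qed.

End RealGraph.

(** Both cost models are instances: a model only has to supply a polynomial bound for the length of
    signed sums of inputs. *)
Lemma otvw_solvable (K : realFieldType) (len : K -> nat)
    (lenb : nat -> nat -> nat) (D : ewgraph K -> Prop)
    (sol : ewgraph K -> seq K -> Prop) :
  (forall xs m k a, (forall b, b \in xs -> len b <= m)%N ->
     signed_sum xs k a -> (len a <= lenb k m)%N) ->
  (forall f, is_polynomial f -> is_polynomial (fun m => lenb (f m) m)) ->
  (forall G (rk : vertex G -> nat), D G -> greedy_rank rk ->
     sol G [seq rank_payment rk v | v <- enum (vertex G)]) ->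
  solvable_in_polytime len (@encode K) D sol.
Proof.
move=> len_le lenb_poly solP.
have [q qE] := polynomial_time_bound lenb_poly otvw_program.
exists otvw_program, q => G DG.
have [t [s [es tm [rk rkG out]]]] := otvw_program_correct G len_le.
by exists t, s; rewrite -qE out; split=> //; apply: solP.
Qed.

Theorem theorem3p4 (R : realType) :
  otvw_polytime R (fun (K : realFieldType) (G : ewgraph K) =>
    forall u : vertex G,
      threshold u \in
        [:: \sum_(e in incident u) weight e - min_weight G;
            \sum_(e in incident u) weight e]).
Proof.
split.
- apply: (@otvw_solvable _ _ (fun _ _ => 1%N)) => // [f _|G rk GD rkG].
    exact: polynomial_const.
  exists (rank_payment rk); split=> //.
  apply: (greedy_rank_optimal (min_weight_ge0 G)) rkG => [e|v].
    exact: min_weight_le.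
  by rewrite -sum_incident.
- apply: (@otvw_solvable _ _ rat_sum_len) => [xs m k a||G rk GD rkG].
  + exact: rat_len_signed_sum.
  + exact: polynomial_rat_sum_len.
  exists (rank_payment rk); split=> //.
  rewrite -(boolp.funext (@rank_payment_real R G rk)).
  (* The discount is the image of the rational minimum; its sign and its being a lower bound for the
     weights carry over along [ratr]. *)
  apply: (@greedy_rank_optimal _ (real_ewgraph R G) (ratr (min_weight G))).
  + by rewrite ler0q min_weight_ge0.
  + by move=> e eG; rewrite ler_rat min_weight_le.
  + move=> v; rewrite degree_real -rmorphB -sum_incident.
    by have := GD v; rewrite !inE /= !(inj_eq (fmorph_inj _)).
  + exact: greedy_rank_real.
Qed.
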